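(* Let $A$ be a finite dimensional $K$-algebra and let $\Gamma$ be a quiver of reduced rank one without cycles of length $2$. A splitted, unital and factorizable representation of $\Gamma$ over $A$ is uniquely defined by a set $(M_i)_{i\in\Gamma^0}$ of two-sided ideals of $A$ and a set $(B_i)_{i\in\Gamma^0}$ of unital subalgebras of $A$ that satisfy the following two conditions: (1) for each vertex $i\in\Gamma^0$, $A=B_i\oplus M_i$; (2) for each arrow $\alpha$ which is not a loop, $M_{s(\alpha)}M_{t(\alpha)}=0$.
   Context: $K$ is a field; algebras are associative and unital. A quiver $\Gamma$ has a vertex set $\Gamma^0$, an arrow set $\Gamma^1$, and source and target maps $s,t$. $\Gamma^1(i,j)$ is the set of arrows from $i$ to $j$; $\Gamma^2(i,j)$ is the set of pairs $(\alpha_1,\alpha_2)$ of arrows with $s(\alpha_1)=i$, $t(\alpha_1)=s(\alpha_2)$, $t(\alpha_2)=j$. Throughout, $\Gamma$ is finite, has no multiple arrows ($\#\Gamma^1(i,j)\le 1$ for all $i,j$), and every vertex carries a (unique) loop. A cycle of length $2$ consists of two distinct vertices $i\neq j$ with an arrow $i\to j$ and an arrow $j\to i$. $\mathrm{rrank}(i)=\#\{\alpha\in\Gamma^1\mid t(\alpha)=i,\ s(\alpha)\neq i\}$, and the reduced rank of $\Gamma$ is $\max_i\mathrm{rrank}(i)$. A representation of $\Gamma$ over $A$ is a representation with the vector space $A$ at every vertex, i.e. a family $(\varphi_\alpha)_{\alpha\in\Gamma^1}$ of $K$-linear maps $A\to A$. It is: splitted if for every vertex $i$ and all arrows $\alpha',\alpha''$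 with target $i$, $\varphi_{\alpha'}\circ\varphi_{\alpha''}=\delta_{s(\alpha'),s(\alpha'')}\varphi_{\alpha'}$, and $\sum_{t(\alpha)=i}\varphi_\alpha=\mathrm{Id}_A$; unital if $\varphi_\alpha(1_A)=\delta_{s(\alpha),t(\alpha)}1_A$ for every arrow $\alpha$; factorizable if for all vertices $i,j$ and $a,b\in A$, $\sum_{(\alpha_1,\alpha_2)\in\Gamma^2(i,j)}\varphi_{\alpha_1}(a)\varphi_{\alpha_2}(b)$ equals $\varphi_\alpha(ab)$ if $\Gamma^1(i,j)=\{\alpha\}$, and $0$ if $\Gamma^1(i,j)=\emptyset$. The data are related to the representation as follows: writing $\varphi_i$ for the map attached to the loop at $i$, $B_i=\mathrm{Im}\,\varphi_i$ and $M_i=\mathrm{Ker}\,\varphi_i$; conversely $\varphi_i$ is the projection of $A=B_i\oplus M_i$ onto $B_i$ followed by the inclusion $B_i\subseteq A$.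
   Formalization: The formal statement adds the condition that M_i = 0 at each vertex i whose only incoming arrow is its loop; a splitted representation forces this, and without it data satisfying (1) and (2) need not come from any representation. *)

(* Defs.v *)
From HB Require Import structures.
From mathcomp Require Import all_boot all_order all_algebra all_field.

Set Implicit Arguments.
Unset Strict Implicit.
Unset Printing Implicit Defensive.

Import GRing.Theory.
Local Open Scope ring_scope.

(* [arrow_le1] and [loopP] are the standing assumptions on quivers: no multiple
   arrows, and a loop at every vertex (unique by [arrow_le1]). *)
Record quiver := Quiver {
  vertex : finType;
  arrow : finType;
  src : arrow -> vertex;
  tgt : arrow -> vertex;
  loop : vertex -> arrow;
  arrow_le1 : forall i j : vertex,
    (#|[set a : arrow | (src a == i) && (tgt a == j)]| <= 1)%N;
  loopP : forall i : vertex, src (loop i) = i /\ tgt (loop i) = i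
}.

Section Quivers.
Variable G : quiver.

Definition arrows (i j : vertex G) : {set arrow G} :=
  [set a | (src a == i) && (tgt a == j)].

Definition paths2 (i j : vertex G) : {set arrow G * arrow G} :=
  [set p | [&& src p.1 == i, tgt p.1 == src p.2 & tgt p.2 == j]].

Definition rrank (i : vertex G) : nat :=
  #|[set a : arrow G | (tgt a == i) && (src a != i)]|.

Definition reduced_rank : nat := (\max_(i : vertex G) rrank i)%N.

Definition has_2cycle : Prop :=
  exists i j : vertex G, [/\ i <> j, arrows i j <> set0 & arrows j i <> set0].

End Quivers.

Section Representations.
Variables (K : fieldType) (A : falgType K) (G : quiver).

(* Finite functions, so that equality of representations is pointwise. *)
Definition representation := {ffun arrow G -> 'End(A)}.

Implicit Type phi : representation.

Definition splitted phi : Prop :=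
  forall i : vertex G,
    (forall a a' : arrow G, tgt a = i -> tgt a' = i ->
       (phi a \o phi a')%VF = (src a == src a')%:R *: phi a)
    /\ \sum_(a | tgt a == i) phi a = \1%VF.

Definition unital phi : Prop :=
  forall a : arrow G, phi a 1 = (src a == tgt a)%:R.

Definition factorizable phi : Prop :=
  forall (i j : vertex G) (x y : A),
    let S := \sum_(p in paths2 i j) phi p.1 x * phi p.2 y in
    (forall a : arrow G, arrows i j = [set a] -> S = phi a (x * y))
    /\ (arrows i j = set0 -> S = 0).

Definition sfu phi : Prop := [/\ splitted phi, unital phi & factorizable phi].

Definition two_sided_ideal (M : {vspace A}) : Prop :=
  (fullv * M <= M)%VS /\ (M * fullv <= M)%VS.

Definition unital_subalgebra (B : {vspace A}) : Prop :=
  1 \in B /\ (B * B <= B)%VS.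

Definition ideal_subalgebra_data (M B : vertex G -> {vspace A}) : Prop :=
  [/\ forall i, two_sided_ideal (M i),
      forall i, unital_subalgebra (B i),
      forall i, (B i + M i = fullv)%VS /\ (B i :&: M i = 0)%VS
    & forall a : arrow G, src a <> tgt a -> (M (src a) * M (tgt a) = 0)%VS].

Definition loop_ker phi (i : vertex G) : {vspace A} := lker (phi (loop i)).
Definition loop_im phi (i : vertex G) : {vspace A} := limg (phi (loop i)).

(* [daddv_pi U V] is the projection onto U along V. *)
Definition defined_by phi (M B : vertex G -> {vspace A}) : Prop :=
  forall i, [/\ loop_ker phi i = M i, loop_im phi i = B i
              & phi (loop i) = daddv_pi (B i) (M i)].

End Representations.

(* Main.v *)
(** In reduced rank one a vertex i receives, besides its loop, at most one arrow
    a, so a splitted representation is determined by the idempotents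
    p_i = phi_(loop i), with phi_a = 1 - p_i (and p_i = 1 if there is no such a).
    Without 2-cycles the only path of length two from i to i runs twice through
    the loop, so factorizability at (i, i) says that p_i is multiplicative, i.e.
    that its kernel is an ideal and its image a subalgebra. Along a nonloop
    a : i -> j it reads p_i x (y - p_j y) + (x - p_i x) p_j y = xy - p_j (xy),
    which amounts to (x - p_i x)(y - p_j y) = 0, that is M_i M_j = 0. *)

Require Import Defs.
From HB Require Import structures.
From mathcomp Require Import all_boot all_order all_algebra all_field.

Import GRing.Theory.
Local Open Scope ring_scope.

(** * Incoming arrows and paths of length two *)

Section QuiverFacts.
Set Implicit Arguments.
Unset Strict Implicit.

Variable G : quiver.
Implicit Types (a b : arrow G) (i j k : vertex G).

Lemma src_loop i : src (loop i) = i. Proof. by case: (loopP i). Qed.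
Lemma tgt_loop i : tgt (loop i) = i. Proof. by case: (loopP i). Qed.

Lemma arrow_inj a b : src a = src b -> tgt a = tgt b -> a = b.
Proof.
move=> es et; have /card_le1_eqP := arrow_le1 (src b) (tgt b).
by apply; rewrite inE ?es ?et !eqxx.
Qed.

Lemma loop_eq a : src a = tgt a -> a = loop (tgt a).
Proof. by move=> e; apply: arrow_inj; rewrite ?src_loop ?tgt_loop. Qed.

Lemma arrows_single a : arrows (src a) (tgt a) = [set a].
Proof.
apply/setP=> b; rewrite !inE; apply/andP/eqP=> [[/eqP es /eqP et]|->//].
exact: arrow_inj.
Qed.

Lemma no_2cycleP a b :
  ~ has_2cycle G -> src a = tgt b -> tgt a = src b -> src a = tgt a.
Proof.
move=> n2 e1 e2; apply/eqP/negPn/negP=> /eqP ne; apply: n2.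
exists (src a), (tgt a); split=> //; apply/eqP/set0Pn.
- by exists a; rewrite inE !eqxx.
- by exists b; rewrite inE e1 e2 !eqxx.
Qed.

Hypothesis rank1 : reduced_rank G = 1%N.

(** Otherwise the common target would have [rrank] at least two. Reduced rank one enters the later
    arguments through this fact. *)
Lemma nonloop_inj a b :
  src a <> tgt a -> src b <> tgt b -> tgt a = tgt b -> a = b.
Proof.
move=> /eqP na /eqP nb et.
have: (rrank (tgt b) <= 1)%N by rewrite -rank1; apply: leq_bigmax.
move/card_le1_eqP; apply; rewrite !inE ?et ?eqxx //=.
by rewrite -et.
Qed.

Lemma incoming_nonloop b :
  src b <> tgt b -> [set a | tgt a == tgt b] = [set loop (tgt b); b].
Proof.
move=> nb; apply/setP=> a; rewrite !inE; apply/eqP/orP=> [et|].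
  case: (eqVneq (src a) (tgt a)) => [/loop_eq ->|/eqP na].
    by left; rewrite et.
  by right; apply/eqP/nonloop_inj.
by case=> /eqP->; rewrite ?tgt_loop.
Qed.

Lemma incoming_rrank0 i : rrank i = 0%N -> [set a | tgt a == i] = [set loop i].
Proof.
move/cards0_eq/setP=> r0; apply/setP=> a; rewrite !inE.
apply/eqP/eqP=> [et|->]; last exact: tgt_loop.
move: (r0 a); rewrite !inE et eqxx /= => /negbFE/eqP es.
by rewrite -et; apply: loop_eq; rewrite es.
Qed.

Lemma rrank0_or_nonloop i :
  rrank i = 0%N \/ exists2 a, src a <> tgt a & tgt a = i.
Proof.
case: (posnP (rrank i)) => [|/card_gt0P[a]]; [by left|rewrite inE].
by case/andP=> /eqP et /eqP ne; right; exists a; rewrite ?et.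
Qed.

Lemma sum_incoming_nonloop (V : nmodType) (F : arrow G -> V) b :
  src b <> tgt b -> \sum_(a | tgt a == tgt b) F a = F (loop (tgt b)) + F b.
Proof.
move=> nb; rewrite -big_set incoming_nonloop // big_setU1 ?big_set1 //=.
by rewrite inE; apply/eqP=> e; apply: nb; rewrite -e src_loop tgt_loop.
Qed.

Lemma sum_incoming_rrank0 (V : nmodType) (F : arrow G -> V) i :
  rrank i = 0%N -> \sum_(a | tgt a == i) F a = F (loop i).
Proof. by move=> r0; rewrite -big_set incoming_rrank0 // big_set1. Qed.

Hypothesis no2 : ~ has_2cycle G.

(** If the middle vertex differed from [i], the two arrows would form a 2-cycle; so both are loops
    at [i]. *)
Lemma paths2_loop i : paths2 i i = [set (loop i, loop i)].
Proof.
apply/setP=> -[a b]; rewrite !inE /=; apply/and3P/eqP; last first.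
  by case=> -> ->; rewrite src_loop tgt_loop.
case=> /eqP es /eqP em /eqP et.
have la: src a = tgt a by apply: (@no_2cycleP a b); rewrite // es et.
have lb: src b = tgt b by rewrite -em -la es et.
by rewrite (loop_eq la) (loop_eq lb) -la es et.
Qed.

(** Split on the second arrow [c] of a path. If [c] is a loop, the first arrow is parallel to [a],
    hence equal to it; otherwise [c] and [a] are nonloops with the same target, so [c = a] and the
    first arrow is a loop. *)
Lemma paths2_nonloop a : src a <> tgt a ->
  paths2 (src a) (tgt a) = [set (loop (src a), a); (a, loop (tgt a))].
Proof.
move=> na; apply/setP=> -[b c]; rewrite !inE /=; apply/and3P/orP; last first.
  by case=> /eqP[-> ->]; rewrite ?src_loop ?tgt_loop.
case=> /eqP es /eqP em /eqP et.
case: (eqVneq (src c) (tgt c)) => [lc|/eqP nc].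
  right; rewrite (loop_eq lc) et; apply/eqP; congr (_, _).
  by apply: arrow_inj; rewrite // em lc.
left; have ec: c = a by apply: nonloop_inj.
have lb: src b = tgt b by rewrite em ec.
by rewrite (loop_eq lb) em ec.
Qed.

Lemma sum_paths2_nonloop (V : nmodType) (F : arrow G * arrow G -> V) a :
  src a <> tgt a ->
  \sum_(q in paths2 (src a) (tgt a)) F q
  = F (loop (src a), a) + F (a, loop (tgt a)).
Proof.
move=> na; rewrite paths2_nonloop // big_setU1 ?big_set1 //=.
by rewrite inE; apply/eqP=> -[_ e]; apply: na; rewrite e src_loop tgt_loop.
Qed.

End QuiverFacts.

(** * Idempotents, direct sums and multiplicative projections *)

Section Projections.
Set Implicit Arguments.
Unset Strict Implicit.

Variables (K : fieldType) (A : falgType K).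
Implicit Types (f : 'End(A)) (x y : A) (B M : {vspace A}).

Lemma sub_proj_ker f x : (f \o f)%VF = f -> x - f x \in lker f.
Proof. by move=> ff; rewrite memv_ker linearB /= -comp_lfunE ff subrr. Qed.

Lemma limg_fixP f x : (f \o f)%VF = f -> reflect (f x = x) (x \in limg f).
Proof.
move=> ff; apply: (iffP memv_imgP) => [[y _ ->]|fx].
  by rewrite -comp_lfunE ff.
by exists x; rewrite ?memvf.
Qed.

Lemma proj_decomp f : (f \o f)%VF = f ->
  (limg f + lker f = fullv)%VS /\ (limg f :&: lker f = 0)%VS.
Proof.
move=> ff; split; apply/eqP; last first.
  rewrite -subv0; apply/subvP=> x; rewrite memv_cap memv0 memv_ker.
  by case/andP=> /(limg_fixP _ ff) ->.
rewrite eqEsubv subvf; apply/subvP=> x _.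
rewrite -[x](subrK (f x)) addrC memv_add ?memv_img ?memvf //.
exact: sub_proj_ker.
Qed.

Lemma daddv_pi_sub B M x : (B + M = fullv)%VS -> (B :&: M = 0)%VS ->
  x - daddv_pi B M x \in M.
Proof.
move=> full dis; rewrite -{1}(daddv_pi_add dis (w := x)) ?full ?memvf //.
by rewrite addrC addKr memv_pi.
Qed.

Lemma daddv_pi_eq0 B M x : (B + M = fullv)%VS -> (B :&: M = 0)%VS ->
  (daddv_pi B M x == 0) = (x \in M).
Proof.
move=> full dis; apply/eqP/idP=> [e|xM].
  by rewrite -[x]subr0 -e daddv_pi_sub.
(* The projection of [x] lies in [B], and also in [M] as the difference of [x] and its
   [M]-component. *)
apply/eqP; rewrite -memv0 -dis memv_cap memv_pi -[X in X \in M]opprK memvN.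
by rewrite -[- _](addKr x) memvD ?memvN ?daddv_pi_sub.
Qed.

(** Both maps take values in [limg f], and each differs from the identity by a map into [lker f]; so
    their difference lands in the intersection of image and kernel, which is zero. *)
Lemma proj_daddv_pi f : (f \o f)%VF = f -> f = daddv_pi (limg f) (lker f).
Proof.
move=> ff; have [full dis] := proj_decomp ff.
apply/lfunP=> x; apply/eqP; rewrite -subr_eq0 -memv0 -dis memv_cap.
rewrite memvB ?memv_pi ?memv_img ?memvf //=.
have -> : f x - daddv_pi (limg f) (lker f) x
  = (x - daddv_pi (limg f) (lker f) x) - (x - f x).
  by rewrite opprB [RHS]addrC addrA subrK.
by rewrite memvB ?daddv_pi_sub ?sub_proj_ker.
Qed.

Lemma daddv_pi_idem B M : (B + M = fullv)%VS -> (B :&: M = 0)%VS ->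
  (daddv_pi B M \o daddv_pi B M)%VF = daddv_pi B M.
Proof. by move=> full dis; apply/lfunP=> x; rewrite comp_lfunE daddv_pi_proj. Qed.

Lemma lker_daddv_pi B M : (B + M = fullv)%VS -> (B :&: M = 0)%VS ->
  lker (daddv_pi B M) = M.
Proof. by move=> full dis; apply/vspaceP=> x; rewrite memv_ker daddv_pi_eq0. Qed.

Lemma limg_daddv_pi B M : (B :&: M = 0)%VS -> limg (daddv_pi B M) = B.
Proof.
move=> dis; apply/vspaceP=> x; apply/memv_imgP/idP=> [[y _ ->]|xB].
  exact: memv_pi.
by exists x; rewrite ?memvf // daddv_pi_id.
Qed.

Lemma two_sided_ideal_lker f :
  {morph f : x y / x * y} -> two_sided_ideal (lker f).
Proof.
move=> fM; split; apply/prodvP=> x y; rewrite !memv_ker fM.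
- by move=> _ /eqP->; rewrite mulr0.
- by move=> /eqP-> _; rewrite mul0r.
Qed.

Lemma unital_subalgebra_limg f :
  {morph f : x y / x * y} -> f 1 = 1 -> unital_subalgebra (limg f).
Proof.
move=> fM f1; split; first by rewrite -f1 memv_img ?memvf.
apply/prodvP=> x y /memv_imgP[x' _ ->] /memv_imgP[y' _ ->].
by rewrite -fM memv_img ?memvf.
Qed.

(** Modulo the ideal [M] every element equals its projection, so [x * y] is congruent to the product
    of the projections; that product lies in the subalgebra [B], where the projection acts as the
    identity. *)
Lemma daddv_pi_morph B M : (B + M = fullv)%VS -> (B :&: M = 0)%VS ->
  unital_subalgebra B -> two_sided_ideal M ->
  {morph daddv_pi B M : x y / x * y}.
Proof.
move=> full dis [_ BB] [AM MA] x y; set p := daddv_pi B M.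
have -> : x * y = p x * p y + (x * (y - p y) + (x - p x) * p y).
  by rewrite mulrBr mulrBl subrKA [RHS]addrC subrK.
rewrite linearD /= (daddv_pi_id dis); last first.
  by apply: (subvP BB); rewrite memv_mul ?memv_pi.
rewrite [X in _ + X](_ : _ = 0) ?addr0 //; apply/eqP.
rewrite daddv_pi_eq0 // memvD //.
- by apply: (subvP AM); rewrite memv_mul ?memvf ?daddv_pi_sub.
- by apply: (subvP MA); rewrite memv_mul ?memvf ?daddv_pi_sub.
Qed.

End Projections.

(** Meant for the projections [p] and [q] at the source and target of a nonloop: for multiplicative
    [q] the left side is then the defect of factorizability, and the right side a product of kernel
    elements. *)
Lemma subr_mul_expand (R : pzRingType) (p q : R -> R) (x y : R) :
  x * y - q x * q y - (p x * (y - q y) + (x - q x) * q y)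
  = (x - p x) * (y - q y).
Proof.
have -> : x * y - q x * q y = x * (y - q y) + (x - q x) * q y.
  by rewrite mulrBr mulrBl addrA subrK.
by rewrite opprD addrACA subrr addr0 mulrBl.
Qed.

(** * From representations to ideals and subalgebras *)

Section RankOne.

Set Implicit Arguments.
Unset Strict Implicit.

Variables (K : fieldType) (A : falgType K) (G : quiver).
Hypotheses (rank1 : reduced_rank G = 1%N) (no2 : ~ has_2cycle G).
Implicit Types (phi : representation A G) (M B : vertex G -> {vspace A}).

Lemma splitted_loop_idem phi i : splitted phi ->
  (phi (loop i) \o phi (loop i))%VF = phi (loop i).
Proof.
by move/(_ i)=> [H _]; rewrite (H _ _ (tgt_loop i) (tgt_loop i)) eqxx scale1r.
Qed.

Lemma splitted_nonloop phi a : splitted phi -> src a <> tgt a ->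
  phi a = \1%VF - phi (loop (tgt a)).
Proof.
move=> /(_ (tgt a))[_ <-] na.
by rewrite sum_incoming_nonloop // [RHS]addrC addKr.
Qed.

Lemma splitted_rrank0 phi i : splitted phi -> rrank i = 0%N ->
  phi (loop i) = \1%VF.
Proof. by move=> /(_ i)[_ <-] r0; rewrite sum_incoming_rrank0. Qed.

Lemma factorizable_loop_morph phi i : factorizable phi ->
  {morph phi (loop i) : x y / x * y}.
Proof.
move=> /(_ i i) fact x y; have [/(_ (loop i)) H _] := fact x y.
have {}H := H _; rewrite -H ?paths2_loop ?big_set1 //.
by rewrite -arrows_single src_loop tgt_loop.
Qed.

(** For [x] and [y] killed by the loop maps at source and target, the terms of both paths vanish.
    The other side of factorizability is [x * y] minus its image under the target loop map, and that
    image is zero because this map is multiplicative and kills [y]. *)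
Lemma sfu_ker_mul phi a : sfu phi -> src a <> tgt a ->
  (loop_ker phi (src a) * loop_ker phi (tgt a) = 0)%VS.
Proof.
move=> [spl uni fact] na; apply/eqP; rewrite -subv0; apply/prodvP=> x y.
rewrite /loop_ker !memv_ker memv0 => /eqP kx /eqP ky.
have [/(_ a (arrows_single a)) + _] := fact (src a) (tgt a) x y.
rewrite sum_paths2_nonloop //= kx ky mul0r mulr0 addr0 splitted_nonloop //.
rewrite add_lfunE opp_lfunE id_lfunE factorizable_loop_morph // ky mulr0 subr0.
by move<-.
Qed.

Lemma sfu_data phi : sfu phi ->
  ideal_subalgebra_data (loop_ker phi) (loop_im phi).
Proof.
move=> sfu_phi; have [spl uni fact] := sfu_phi; split=> [i|i|i|a].
- exact/two_sided_ideal_lker/factorizable_loop_morph.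
- apply: unital_subalgebra_limg; first exact: factorizable_loop_morph.
  by rewrite uni src_loop tgt_loop eqxx.
- exact/proj_decomp/splitted_loop_idem.
- exact: sfu_ker_mul.
Qed.

Lemma splitted_defined_by phi : splitted phi ->
  defined_by phi (loop_ker phi) (loop_im phi).
Proof.
by move=> spl i; split=> //; apply/proj_daddv_pi/splitted_loop_idem.
Qed.

(** A nonloop gets the complementary projection, since splitting at its target forces the two
    incoming maps to add up to the identity. *)
Definition rep_of_data M B : representation A G :=
  [ffun a => if src a == tgt a then daddv_pi (B (tgt a)) (M (tgt a))
             else \1%VF - daddv_pi (B (tgt a)) (M (tgt a))].

Lemma rep_of_data_loop M B i : rep_of_data M B (loop i) = daddv_pi (B i) (M i).
Proof. by rewrite ffunE src_loop tgt_loop eqxx. Qed.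

Lemma rep_of_data_nonloop M B a : src a <> tgt a ->
  rep_of_data M B a = \1%VF - daddv_pi (B (tgt a)) (M (tgt a)).
Proof. by rewrite ffunE => /eqP/negPf->. Qed.

Lemma sfu_defined_by_uniq M B phi : sfu phi -> defined_by phi M B ->
  rep_of_data M B = phi.
Proof.
move=> [spl _ _] def; apply/ffunP=> a.
have [_ _ e] := def (tgt a).
case: (eqVneq (src a) (tgt a)) => [/loop_eq la|/eqP na].
  by rewrite la rep_of_data_loop e.
by rewrite rep_of_data_nonloop // splitted_nonloop // e.
Qed.

(** * From ideals and subalgebras back to a representation *)

Section Existence.
Variables M B : vertex G -> {vspace A}.
Hypothesis data : ideal_subalgebra_data M B.
Hypothesis ker0 : forall i, rrank i = 0%N -> M i = 0%VS.

Let phi := rep_of_data M B.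
Let p i := daddv_pi (B i) (M i).

Let full i : (B i + M i = fullv)%VS. Proof. by case: data => _ _ /(_ i)[]. Qed.
Let dis i : (B i :&: M i = 0)%VS. Proof. by case: data => _ _ /(_ i)[]. Qed.
Let pM i : {morph p i : x y / x * y}.
Proof. by case: data => id sub _ _; exact: daddv_pi_morph. Qed.

Let phi_nonloop_in a x : src a <> tgt a -> phi a x \in M (tgt a).
Proof.
move=> na; rewrite /phi rep_of_data_nonloop // add_lfunE opp_lfunE id_lfunE.
exact: daddv_pi_sub.
Qed.

Let mul_ker0 a x y : src a <> tgt a ->
  x \in M (src a) -> y \in M (tgt a) -> x * y = 0.
Proof.
move=> na xM yM; case: data => _ _ _ /(_ a na) MM.
by apply/eqP; rewrite -memv0 -MM memv_mul.
Qed.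

Lemma rep_of_data_defined_by : defined_by phi M B.
Proof.
move=> i; rewrite /loop_ker /loop_im /phi rep_of_data_loop.
by split; rewrite ?lker_daddv_pi ?limg_daddv_pi.
Qed.

Lemma rep_of_data_splitted : splitted phi.
Proof.
move=> i; have pp := daddv_pi_idem (full i) (dis i); split=> [a b|].
  have [r0|[c nc ec]] := rrank0_or_nonloop i.
    move=> ea eb.
    have inl d : tgt d = i -> d = loop i.
      by move=> ed; apply/set1P; rewrite -incoming_rrank0 // inE ed.
    rewrite (inl a ea) (inl b eb) eqxx scale1r /phi rep_of_data_loop.
    exact: pp.
  move=> ea eb.
  have inl d : tgt d = i -> d = loop i \/ d = c.
    move=> ed; apply/set2P; rewrite -ec.
    by rewrite -incoming_nonloop // inE ec ed.
  have sc : src c != i by rewrite -ec; apply/eqP.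
  have ec' : phi c = \1%VF - p i by rewrite /phi rep_of_data_nonloop // ec.
  have el : phi (loop i) = p i by rewrite /phi rep_of_data_loop.
  (* The four products of the idempotents [p i] and [1 - p i]: equal factors reproduce themselves,
     distinct ones annihilate each other. *)
  case: (inl a ea) => ->; case: (inl b eb) => ->; rewrite ?ec' ?el ?src_loop.
  - by rewrite eqxx scale1r.
  - rewrite eq_sym (negPf sc) scale0r; apply/lfunP=> x.
    rewrite !lfun_simp /= linearB /= [p i (p i x)](daddv_pi_proj _ (dis i)).
    by rewrite subrr.
  - rewrite (negPf sc) scale0r; apply/lfunP=> x.
    rewrite !lfun_simp /= [p i (p i x)](daddv_pi_proj _ (dis i)).
    by rewrite subrr.
  - rewrite eqxx scale1r; apply/lfunP=> x.
    rewrite !lfun_simp /= linearB /= [p i (p i x)](daddv_pi_proj _ (dis i)).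
    by rewrite subrr subr0.
have [r0|[c nc <-]] := rrank0_or_nonloop i.
  rewrite sum_incoming_rrank0 // /phi rep_of_data_loop.
  apply/lfunP=> x; rewrite id_lfunE; apply/eqP.
  (* The loop map alone must be the identity here; its defect [x - p i x] lies in [M i], which is
     zero by [ker0]. *)
  rewrite eq_sym -subr_eq0 -memv0 -(ker0 r0).
  exact: daddv_pi_sub.
rewrite sum_incoming_nonloop // /phi rep_of_data_loop rep_of_data_nonloop //.
by rewrite addrC subrK.
Qed.

Lemma rep_of_data_unital : unital phi.
Proof.
move=> a; have p1 : p (tgt a) 1 = 1.
  by apply: daddv_pi_id; case: data => _ /(_ (tgt a))[].
rewrite /phi ffunE; case: eqP => _ //.
by rewrite add_lfunE opp_lfunE id_lfunE p1 subrr.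
Qed.

Lemma rep_of_data_factorizable : factorizable phi.
Proof.
move=> i j x y; split=> [a ea|e0]; last first.
  (* Without an arrow i -> j, both arrows of a path i -> k -> j are non-loops,
     and the second one gives M_k M_j = 0. *)
  apply: big1 => -[b c]; rewrite inE /= => /and3P[/eqP es /eqP em /eqP et].
  have noarr d : src d = i -> tgt d <> j.
    move=> ed ed'; have: d \in arrows i j by rewrite inE ed ed' !eqxx.
    by rewrite e0 inE.
  have nc : src c <> tgt c.
    by move=> lc; apply: (noarr b es); rewrite em lc.
  have nb : src b <> tgt b.
    by move=> lb; apply: (noarr c _ et); rewrite -em -lb.
  by apply: (mul_ker0 nc); rewrite -?em phi_nonloop_in.
have: a \in arrows i j by rewrite ea set11.
rewrite inE => /andP[/eqP ei /eqP ej]; rewrite -ei -ej.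
case: (eqVneq (src a) (tgt a)) => [la|/eqP na].
  rewrite la paths2_loop // big_set1 /= [in RHS](loop_eq la).
  by rewrite /phi rep_of_data_loop -/(p _) pM.
rewrite sum_paths2_nonloop //= /phi !rep_of_data_loop rep_of_data_nonloop //.
rewrite !(add_lfunE, opp_lfunE, id_lfunE) -/(p _) -/(p _) pM.
(* The defect factors as the [M (src a)]-component of [x] times the [M (tgt a)]-component of [y]. *)
apply/esym/eqP; rewrite -subr_eq0 subr_mul_expand; apply/eqP.
by apply: (mul_ker0 na); apply: daddv_pi_sub.
Qed.

End Existence.

End RankOne.

(** The two halves are the two directions of a bijection between representations and data. The data
    must also satisfy [M i = 0] where [rrank i = 0]: splitting makes the loop map the identity
    there, which conditions (1) and (2) do not guarantee. *)
Theorem corollary2p8 (K : fieldType) (A : falgType K) (G : quiver) :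
  reduced_rank G = 1%N -> ~ has_2cycle G ->
  (forall phi : representation A G, sfu phi ->
     [/\ ideal_subalgebra_data (loop_ker phi) (loop_im phi),
         forall i : vertex G, rrank i = 0%N -> loop_ker phi i = 0%VS
       & defined_by phi (loop_ker phi) (loop_im phi)])
  /\
  (forall M B : vertex G -> {vspace A},
     ideal_subalgebra_data M B ->
     (forall i : vertex G, rrank i = 0%N -> M i = 0%VS) ->
     exists! phi : representation A G, sfu phi /\ defined_by phi M B).
Proof.
move=> rank1 no2; split=> [phi sfu_phi|M B data ker0].
  have [spl _ _] := sfu_phi; split; [exact: sfu_data| |exact: splitted_defined_by].
  move=> i r0; apply/vspaceP=> x.
  by rewrite memv_ker splitted_rrank0 // id_lfunE memv0.
exists (rep_of_data M B); split; last first.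
  by move=> phi [sfu_phi def]; exact: sfu_defined_by_uniq.
split; last exact: rep_of_data_defined_by.
split; [exact: rep_of_data_splitted|exact: rep_of_data_unital|].
exact: rep_of_data_factorizable.
Qed.
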